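(* Let $k \geq 2$ be an integer, let $q=p^n$ be a prime power ($p$ prime, $n\ge 1$) with $q \equiv 1 \bmod 2k$, and suppose that the generalized Paley graph $\mathcal{P}(q, k)$ is disconnected. Then there is a proper divisor $a$ of $n$ such that $(q-1)/(p^a-1)$ divides $k$, and, taking $a$ to be the smallest such proper divisor of $n$, each connected component of $\mathcal{P}(q, k)$ is isomorphic to the generalized Paley graph $\mathcal{P}(p^a, k')$ with $k' = k (p^a-1)/(q-1) \geq 1$.
   Context: For an integer $k\ge 1$ and a finite field $\mathbb{F}_q$ of order $q=p^n$, let $(\mathbb{F}_q^{\times})^k=\{\alpha\in\mathbb{F}_q^\times \mid \alpha=\beta^k \text{ for some } \beta\in\mathbb{F}_q^\times\}$. If $q \equiv 1 \bmod 2k$, the generalized Paley graph $\mathcal{P}(q,k)$ is the simple undirected graph with vertex set $\mathbb{F}_q$ in which $x,y$ are adjacent if and only if $x-y\in(\mathbb{F}_q^\times)^k$. (The congruence guarantees $q$ is odd and $-1\in(\mathbb{F}_q^\times)^k$.) The case $k=1$ is allowed for $\mathcal{P}(p^a,k')$: $\mathcal{P}(q,1)$ is the complete graph $K_q$. A proper divisor of $n$ is a positive divisor $a$ of $n$ with $a<n$. *)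

(* Defs.v *)
From HB Require Import structures.
From mathcomp Require Import all_boot all_order all_algebra all_fingroup.
From mathcomp Require Import all_solvable all_field.
Set Implicit Arguments.
Unset Strict Implicit.
Unset Printing Implicit Defensive.
Import GRing.Theory.
Local Open Scope ring_scope.

Definition kth_powers (F : finFieldType) (k : nat) : {set F} :=
  [set b ^+ k | b : F & b != 0].

Definition paley (F : finFieldType) (k : nat) : rel F :=
  [rel x y | x - y \in kth_powers F k].
Arguments paley F k : clear implicits.

Lemma paley_irrefl (F : finFieldType) (k : nat) : irreflexive (paley F k).
Proof.
move=> x; rewrite /paley /= subrr; apply/negbTE/imsetP => -[b]; rewrite inE => b0 e.
by move/eqP: e; rewrite eq_sym expf_eq0 (negbTE b0) andbF.
Qed.

Lemma paley_sym (F : finFieldType) (k : nat) :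
  (#|F| = 1 %[mod 2 * k])%N -> symmetric (paley F k).
Proof.
move=> hq.
have F_gt1 := finNzRing_gt1 F.
have d2k : (2 * k %| #|F|.-1)%N.
  by rewrite -subn1 -eqn_mod_dvd ?(ltnW F_gt1) //; apply/eqP.
have [m qE] : exists m, #|F|.-1 = (2 * k * m)%N.
  by case/dvdnP: d2k => m ->; exists m; rewrite mulnC.
have [c [c0 cE]] : exists c : F, c != 0 /\ c ^+ k = -1.
  have [g g_prim] : exists g : F, #|F|.-1.-primitive_root g.
    pose rs := enum [pred x : F | x != 0].
    have : has (#|F|.-1).-primitive_root rs.
      apply: has_prim_root.
      - by rewrite -subn1 subn_gt0.
      - apply/allP => x; rewrite mem_enum inE => x0; rewrite unity_rootE.
        apply/eqP; apply: (mulfI x0).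
        by rewrite -exprS prednK ?(ltnW F_gt1) // expf_card mulr1.
      - exact: enum_uniq.
      - by rewrite -cardE cardC1.
    by case/hasP => g _; exists g.
  have q1_gt0 : (0 < #|F|.-1)%N by rewrite -subn1 subn_gt0.
  have hm : (0 < k * m)%N by move: q1_gt0; rewrite qE -mulnA muln_gt0.
  have sq : (g ^+ m ^+ k) ^+ 2 = 1.
    by rewrite -!exprM -(prim_expr_order g_prim) qE; congr (_ ^+ _); rewrite mulnC (mulnC k).
  have ne1 : g ^+ m ^+ k != 1.
    rewrite -exprM -(prim_order_dvd g_prim) qE -mulnA (mulnC m); apply/negP.
    by move/(dvdn_leq hm); rewrite leqNgt ltn_Pmull.
  exists (g ^+ m); split.
    rewrite expf_eq0; apply/negP => /andP [_ /eqP g0].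
    move: (prim_expr_order g_prim) => /eqP.
    by rewrite g0 expr0n eqn0Ngt q1_gt0 eq_sym oner_eq0.
  by move/eqP: sq; rewrite sqrf_eq1 (negbTE ne1) => /eqP.
have half x y : paley F k x y -> paley F k y x.
  rewrite /paley /= => /imsetP [b]; rewrite inE => b0 e; apply/imsetP; exists (c * b).
    by rewrite inE mulf_neq0.
  by rewrite exprMn cE mulN1r -e opprB.
by move=> x y; apply/idP/idP; apply: half.
Qed.

Definition graph_connected (T : finType) (e : rel T) : Prop :=
  forall x y : T, connect e x y.

(* The subgraph induced on the vertices reachable from x; for symmetric e these
   are exactly the connected components of e, as x varies. *)
Definition component (T : finType) (e : rel T) (x : T) :
    rel {y : T | connect e x y} :=
  [rel u v | e (val u) (val v)].
Arguments component {T} e x _ _.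

Definition graph_iso (T1 T2 : Type) (e1 : rel T1) (e2 : rel T2) : Prop :=
  exists f : T1 -> T2,
    bijective f /\ forall u v : T1, e2 (f u) (f v) = e1 u v.

Definition proper_divisor (a n : nat) : Prop :=
  [/\ (0 < a)%N, (a %| n)%N & (a < n)%N].

(* Main.v *)
(** Put m = (q - 1) / k, so that the k-th powers of F are the m-th roots of
    unity. They are closed under multiplication, so their additive span E is a
    subfield, and the components of the Paley graph are the cosets of E (in
    characteristic p, spans over the prime field are sums of powers).
    Disconnectedness means |E| = p^b with b a proper divisor of n. For e | n,
    the divisibility (q - 1) / (p^e - 1) | k amounts to m | p^e - 1, i.e. to
    the m-th roots of unity lying in the fixed points of y |-> y^(p^e). It holds
    for b, so the least a satisfies a <= b; and E lies in the fixed points for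
    a, which number at most p^a, so E is the copy of GF(p^a) in F. Finally
    k' = (p^a - 1) / m, so the k'-th powers of GF(p^a) are again the m-th roots
    of unity, which any field embedding preserves. *)

Require Import Defs.
From HB Require Import structures.
From mathcomp Require Import all_boot all_algebra.
From mathcomp Require Import all_solvable all_field.
Set Implicit Arguments.
Unset Strict Implicit.
Unset Printing Implicit Defensive.
Import GRing.Theory.
Local Open Scope ring_scope.

(** * Powers and roots of unity in a finite field *)

Lemma expf_card_pred (F : finFieldType) (x : F) : x != 0 -> x ^+ #|F|.-1 = 1.
Proof.
move=> x0; apply: (mulfI x0).
by rewrite -exprS prednK ?(ltnW (finNzRing_gt1 F)) // expf_card mulr1.
Qed.

Lemma finField_prim_root (F : finFieldType) :
  exists g : F, #|F|.-1.-primitive_root g.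
Proof.
have F_gt1 := finNzRing_gt1 F.
have : has (#|F|.-1).-primitive_root (enum [pred x : F | x != 0]).
  apply: has_prim_root; rewrite ?enum_uniq -?cardE ?cardC1 //.
    by rewrite -subn1 subn_gt0.
  apply/allP => x; rewrite mem_enum inE => x0.
  by rewrite unity_rootE expf_card_pred.
by case/hasP => g _; exists g.
Qed.

(** For a primitive root [g], if [x = g ^+ i] and [x ^+ m = 1], then [k * m] divides [i * m], so [k]
    divides [i]. *)
Lemma kth_powersE (F : finFieldType) (k m : nat) :
  (k * m)%N = #|F|.-1 -> kth_powers F k = [set x | x ^+ m == 1].
Proof.
move=> kmE; have [g g_prim] := finField_prim_root F.
have km_gt0 : (0 < k * m)%N by rewrite kmE (prim_order_gt0 g_prim).
have /andP[k_gt0 m_gt0] : (0 < k)%N && (0 < m)%N by rewrite -muln_gt0.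
apply/setP => x; rewrite inE; apply/imsetP/eqP => [[b]|xm1].
  by rewrite inE => b0 ->; rewrite -exprM kmE expf_card_pred.
have xq1 : x ^+ #|F|.-1 = 1 by rewrite -kmE mulnC exprM xm1 expr1n.
have [i xE] := prim_rootP g_prim xq1.
have kdvi : (k %| i)%N.
  rewrite -(dvdn_pmul2r m_gt0) kmE (prim_order_dvd g_prim) exprM -xE.
  exact/eqP.
exists (g ^+ (i %/ k)); last by rewrite -exprM divnK.
by rewrite inE expf_neq0 // (prim_root_eq0 g_prim) -kmE -lt0n.
Qed.

(** * Connectivity and the span of the k-th powers *)

(** [E] is the span of the k-th powers over the prime field. Each edge changes the vertex by a k-th
    power; conversely, subtracting a linear combination of k-th powers is a walk, since its
    coefficients are residues of naturals. *)
Lemma paley_connect_subfield (F : finFieldType) (p k : nat)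
    (pcharF : p \in [pchar F]) :
  exists E : {subfield pPrimeCharType pcharF},
    forall x y : F, connect (paley F k) x y = (x - y \in E).
Proof.
pose L := pPrimeCharType pcharF; pose S : seq L := enum (kth_powers F k).
have S_mul (s t : L) : s \in S -> t \in S -> s * t \in S.
  rewrite !mem_enum => /imsetP[b]; rewrite inE => b0 ->.
  case/imsetP => c; rewrite inE => c0 ->.
  by apply/imsetP; exists (b * c); rewrite ?inE ?mulf_neq0 ?exprMn.
have S1 : 1 \in S.
  by rewrite mem_enum; apply/imsetP; exists 1; rewrite ?inE ?oner_eq0 ?expr1n.
have aspS : is_aspace <<S>>%VS.
  rewrite /is_aspace has_algid1 ?memv_span //=; apply/prodvP => u v.
  rewrite -[S]/(tval (in_tuple S)) => /coord_span -> /coord_span ->.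
  rewrite mulr_suml; apply: rpred_sum => i _; rewrite mulr_sumr.
  apply: rpred_sum => j _; rewrite -scalerAl -scalerAr !rpredZ //.
  by rewrite memv_span ?S_mul ?mem_nth.
exists (ASpace aspS) => x y; apply/idP/idP.
  case/connectP => r; elim: r x => [|z r IHr] x /=.
    by move=> _ ->; rewrite subrr; exact: mem0v.
  case/andP => xz zr yE; have zy := IHr z zr yE.
  suff xz_in : (x - z : L) \in <<S>>%VS.
    by rewrite -(subrK z x) -addrA; exact: (memvD xz_in zy).
  by rewrite memv_span ?mem_enum.
have step n (s x0 : F) : s \in S -> connect (paley F k) x0 (x0 - s *+ n).
  move=> sS; elim: n => [|n IHn]; first by rewrite subr0.
  apply: connect_trans IHn (connect1 _); rewrite /paley /=.
  by rewrite opprB addrC subrKA mulrSr addrC addKr -mem_enum.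
suff sub v : v \in <<S>>%VS -> forall x0 : F, connect (paley F k) x0 (x0 - v).
  by move=> /sub/(_ x); rewrite opprB addrC subrK.
rewrite -[S]/(tval (in_tuple S)) => /coord_span ->.
elim/big_ind: _ => [x0|u w IHu IHw x0|i _ x0]; first by rewrite subr0.
  by rewrite opprD addrA; apply: connect_trans (IHu _) (IHw _).
(* The scalar action of the prime field is multiplication by the image of a natural number, hence
   repeated addition. *)
have -> : coord (in_tuple S) i v *: S`_i = S`_i *+ (coord (in_tuple S) i v).
  exact: mulr_natl.
by apply: step; rewrite mem_nth.
Qed.

(** * Embeddings of finite fields and their images *)

(** After a factor ['X] is split off, this is the divisibility of [('X^d)^c - 1] by ['X^d - 1]. *)
Lemma dvdp_XnsubX (R : idomainType) (d e : nat) :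
  (d %| e)%N -> ('X^(d.+1) - 'X : {poly R}) %| 'X^(e.+1) - 'X.
Proof.
case/dvdnP => c ->; rewrite !exprS -[X in _ - X]mulr1 -[X in _ %| _ - X]mulr1.
by rewrite -!mulrBr dvdp_mul // mulnC exprM [X in _ %| X]subrX1 dvdp_mulIl.
Qed.

(* A generator [w] of [K] has minimal polynomial dividing [X^(p^a) - X], hence
   [X^(p^n) - X], which splits in [F]; sending [w] to a root [r] there defines
   the morphism. *)
Lemma finField_rmorphism (K F : finFieldType) (p a n : nat) :
    prime p -> (a %| n)%N -> #|K| = (p ^ a)%N -> #|F| = (p ^ n)%N ->
  inhabited {rmorphism K -> F}.
Proof.
move=> p_pr a_n cardK cardF.
have charK := card_finPcharP cardK p_pr; have charF := card_finPcharP cardF p_pr.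
pose KP := pPrimeCharType charK; pose FP := pPrimeCharType charF.
have [w w_prim] : exists w : KP, #|K|.-1.-primitive_root w := finField_prim_root K.
(* [mu] is the minimal polynomial of [w] with coefficients in the prime field itself, so that it can
   be mapped into both [KP] and [FP]. *)
have /polyOver1P[mu muE] := minPolyOver (1%AS : {subfield KP}) w.
have mu_dvd : map_poly (in_alg FP) mu %| 'X^(p ^ n) - 'X.
  have pX_gt0 e : (0 < p ^ e)%N by rewrite expn_gt0 prime_gt0.
  have dvd_pred : ((p ^ a).-1 %| (p ^ n).-1)%N.
    by case/dvdnP: a_n => c ->; rewrite mulnC expnM dvdn_pred_predX.
  apply: (@dvdp_trans _ ('X^(p ^ a) - 'X)); last first.
    by have := dvdp_XnsubX FP dvd_pred; rewrite !prednK.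
  have -> : 'X^(p ^ a) - 'X = map_poly (in_alg FP) ('X^(p ^ a) - 'X).
    by rewrite rmorphB /= map_polyXn map_polyX.
  rewrite dvdp_map -(dvdp_map (in_alg KP)) -muE rmorphB /= map_polyXn map_polyX.
  apply: minPoly_dvdp; first by rewrite rpredB ?rpredX ?polyOverX.
  rewrite /root !hornerE -cardK; apply/eqP; by rewrite (@expf_card K) subrr.
have [r r_root] : exists r : FP, root (map_poly (in_alg FP) mu) r.
  (* ['X^#|F| - 'X] is the product of all ['X - x], so its divisor [mu] is, up to a scalar, a
     product over some of them; being nonconstant, it has at least one factor. *)
  move: mu_dvd; rewrite -cardF (@finField_genPoly F) -big_enum /=.
  case/dvdp_prod_XsubC => msk mu_eq.
  have : (1 < size (map_poly (in_alg FP) mu))%N.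
    by rewrite size_map_poly -(size_map_poly (in_alg KP)) -muE size_minPoly ltnS.
  rewrite (eqp_size mu_eq); case: (mask _ _) mu_eq => [|r s] mu_eq.
    by rewrite big_nil size_poly1.
  by exists r; rewrite (eqp_root mu_eq) big_cons rootM root_XsubC eqxx.
pose evK P := (map_poly (in_alg KP) P).[w].
pose evF P := (map_poly (in_alg FP) P).[r].
(* A polynomial vanishing at [w] is a multiple of [mu], hence vanishes at [r]. This makes [f] below
   independent of the chosen representative. *)
have ev_wd P Q : evK P = evK Q -> evF P = evF Q.
  move=> PQ; apply/eqP; rewrite -subr_eq0.
  have : mu %| P - Q.
    rewrite -(dvdp_map (in_alg KP)) -muE minPoly_dvdp //.
      by apply/polyOver1P; exists (P - Q).
    by rewrite /root rmorphB hornerD hornerN subr_eq0; apply/eqP.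
  rewrite -(dvdp_map (in_alg FP)) => /root_dvdp/(_ r_root).
  by rewrite /root rmorphB hornerD hornerN.
have ev_surj x : exists P, evK P == x.
  have [->|x0] := eqVneq x 0; first by exists 0; rewrite /evK rmorph0 horner0.
  have /(prim_rootP w_prim)[i ->] := @expf_card_pred K x x0.
  by exists 'X^i; rewrite /evK map_polyXn hornerXn.
pose f (x : K) : F := evF (xchoose (ev_surj x)).
have fE P : f (evK P) = evF P.
  by apply: ev_wd; apply/eqP; exact: (xchooseP (ev_surj _)).
have repr x : exists P, x = evK P.
  by have [P /eqP] := ev_surj x; exists P.
have fB : zmod_morphism f.
  move=> x y; have [P ->] := repr x; have [Q ->] := repr y.
  have -> : evK P - evK Q = evK (P - Q) by rewrite /evK rmorphB hornerD hornerN.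
  by rewrite !fE /evF rmorphB hornerD hornerN.
have fM : monoid_morphism f.
  split.
    have -> : 1 = evK 1 by rewrite /evK rmorph1 hornerC.
    by rewrite fE /evF rmorph1 hornerC.
  move=> x y; have [P ->] := repr x; have [Q ->] := repr y.
  have -> : evK P * evK Q = evK (P * Q) by rewrite /evK rmorphM hornerM.
  by rewrite !fE /evF rmorphM hornerM.
pose fA := GRing.isZmodMorphism.Build K F f fB.
pose fR := GRing.isMonoidMorphism.Build K F f fM.
by constructor; exact: (HB.pack f fA fR).
Qed.

(** The image consists of roots of ['X^#|K| - 'X], which has at most [#|K|] of them, and by
    injectivity it has [#|K|] elements. *)
Lemma codom_rmorphism_fixed (K F : finFieldType) (f : {rmorphism K -> F})
    (y : F) :
  (y \in codom f) = (y ^+ #|K| == y).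
Proof.
have szP : size ('X^#|K| - 'X : {poly F}) = #|K|.+1.
  by rewrite size_polyDl ?size_polyXn // size_polyN size_polyX ltnS finNzRing_gt1.
have fixf x : f x ^+ #|K| = f x by rewrite -rmorphXn expf_card.
have sub : codom f \subset [pred y : F | y ^+ #|K| == y].
  by apply/subsetP => _ /codomP[x ->]; rewrite inE fixf.
suff /subset_cardP/(_ sub) -> : #|codom f| = #|[pred y : F | y ^+ #|K| == y]| by [].
apply/eqP; rewrite eqn_leq subset_leq_card //= card_codom; last exact: fmorph_inj.
rewrite cardE -ltnS -szP max_poly_roots ?enum_uniq //.
  by rewrite -size_poly_eq0 szP.
by apply/allP => z; rewrite mem_enum inE /root !hornerE subr_eq0.
Qed.

(* The least divisor and the components *)
Local Close Scope ring_scope.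

Theorem theorem1p1 (p n k q : nat) (F : finFieldType)
    (p_prime : prime p) (n_ge1 : 1 <= n) (k_ge2 : 2 <= k)
    (q_def : q = p ^ n) (q_mod : q = 1 %[mod 2 * k]) (cardF : #|F| = q)
    (disconnected : ~ graph_connected (paley F k)) :
  (exists a : nat, proper_divisor a n /\ (q - 1) %/ (p ^ a - 1) %| k) /\
  (forall a : nat,
     proper_divisor a n -> (q - 1) %/ (p ^ a - 1) %| k ->
     (forall b : nat,
        proper_divisor b n -> (q - 1) %/ (p ^ b - 1) %| k -> a <= b) ->
     let k' := k * (p ^ a - 1) %/ (q - 1) in
     [/\ k' * (q - 1) = k * (p ^ a - 1),
         1 <= k',
         p ^ a = 1 %[mod 2 * k'] &
         forall (K : finFieldType), #|K| = p ^ a ->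
         forall x : F, graph_iso (component (paley F k) x) (paley K k')]).
Proof.
have q_gt1 : 1 < q by rewrite -cardF finNzRing_gt1.
have k_gt0 : 0 < k by apply: ltnW.
have dvd2k : 2 * k %| q - 1.
  by rewrite -eqn_mod_dvd ?(ltnW q_gt1) //; apply/eqP.
have pa_gt1 e : 0 < e -> 0 < p ^ e - 1.
  by move=> e0; rewrite subn_gt0 -[1](exp1n e) ltn_exp2r ?prime_gt1.
have dvd_pa e : e %| n -> p ^ e - 1 %| q - 1.
  rewrite q_def; case/dvdnP => c ->.
  by rewrite mulnC expnM !subn1 dvdn_pred_predX.
have [m mE] : exists m, q - 1 = k * m.
  have /dvdnP[m ->] := dvdn_trans (dvdn_mull 2 (dvdnn k)) dvd2k.
  by exists m; rewrite mulnC.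
have SE : kth_powers F k = [set x | x ^+ m == 1]%R.
  by apply: kth_powersE; rewrite -mE cardF subn1.
have charF : p \in [pchar F]%R by apply: (@card_finPcharP F p n) => //; rewrite cardF.
have [E connE] := paley_connect_subfield k charF.
set b := \dim E.
have cardE : #|[pred y : F | y \in E]| = p ^ b.
  by have := card_vspace E; rewrite card_Fp.
have b_dvd : b %| n.
  have := field_dimS (subvf E); rewrite pprimeChar_dimf.
  have -> : #|pPrimeCharType charF| = p ^ n by rewrite -q_def.
  by rewrite pfactorK.
have b_gt0 : 0 < b := adim_gt0 E.
have b_lt : b < n.
  rewrite ltn_neqAle (dvdn_leq n_ge1 b_dvd) andbT; apply/eqP => bn.
  apply: disconnected => x y; rewrite connE.
  have /subset_cardP/(_ (subset_predT _)) -> // : #|[pred y : F | y \in E]| = #|F|.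
    by rewrite cardE bn cardF.
have bP : proper_divisor b n by [].
(* A primitive m-th root of unity is a k-th power, hence lies in [E]; Fermat's little theorem in [E]
   then bounds its order. *)
have m_dvd : m %| p ^ b - 1.
  have [g] := finField_prim_root F; rewrite cardF -subn1 => g_prim.
  have m_dvd : m %| q - 1 by rewrite mE dvdn_mull.
  have z_prim := dvdn_prim_root g_prim m_dvd.
  set z := (g ^+ _)%R in z_prim.
  have zE : z \in E.
    rewrite -[z]subr0 -connE connect1 // /paley /= subr0 SE inE.
    exact/eqP/(prim_expr_order z_prim).
  have z0 : z != 0%R.
    by rewrite (prim_root_eq0 z_prim) -lt0n (prim_order_gt0 z_prim).
  rewrite (prim_order_dvd z_prim); apply/eqP/(mulfI z0).
  rewrite -exprS subn1 prednK ?expn_gt0 ?prime_gt0 // mulr1.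
  by apply/eqP; have := Fermat's_little_theorem E z; rewrite card_Fp // zE => <-.
(* With [N = p ^ e - 1] and [k * m = d * N], [m] divides [N] exactly when [d] divides [k], with the
   same cofactor. *)
have k_dvd e : 0 < e -> e %| n ->
    (m %| p ^ e - 1) = ((q - 1) %/ (p ^ e - 1) %| k).
  move=> e_gt0 /dvd_pa/dvdnP[d]; have N_gt0 := pa_gt1 _ e_gt0.
  have m_gt0 : 0 < m by move: q_gt1; rewrite -subn_gt0 mE muln_gt0 => /andP[].
  move: (p ^ e - 1) N_gt0 => N N_gt0 dN; rewrite dN mulnK //.
  have d_gt0 : 0 < d by move: q_gt1; rewrite -subn_gt0 dN muln_gt0 => /andP[].
  apply/dvdnP/dvdnP => -[c cE]; exists c; apply/eqP.
    by rewrite -(eqn_pmul2r m_gt0) -mE dN cE mulnCA mulnA.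
  by rewrite -(eqn_pmul2l d_gt0) -dN mE cE -mulnA mulnCA.
split; first by exists b; rewrite -k_dvd.
move=> a [a_gt0 a_dvd a_lt] ka_dvd a_min k'.
(* Minimality of [a] enters here; it yields the cardinality bound in [codomE]. *)
have ab : a <= b by apply: a_min; rewrite -?k_dvd.
have m_dvd_a : m %| p ^ a - 1 by rewrite k_dvd.
have k'm : k' * m = p ^ a - 1.
  have m_gt0 : 0 < m := dvdn_gt0 (pa_gt1 _ a_gt0) m_dvd_a.
  rewrite /k' mE; case/dvdnP: m_dvd_a => c ->.
  by rewrite mulnCA mulnK // muln_gt0 k_gt0.
have k'E : k' * (q - 1) = k * (p ^ a - 1) by rewrite mE mulnCA k'm.
have k'_gt0 : 0 < k' by have := pa_gt1 _ a_gt0; rewrite -k'm muln_gt0 => /andP[].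
have pa_mod : p ^ a = 1 %[mod 2 * k'].
  (* From [2 * k] dividing [k * m], [m] is even, so [2 * k'] divides [k' * m]. *)
  apply/eqP; rewrite eqn_mod_dvd ?expn_gt0 ?prime_gt0 // -k'm mulnC.
  by move: dvd2k; rewrite mE [2 * k]mulnC !dvdn_pmul2l.
split=> // K cardK x.
have [|f] := @finField_rmorphism K F p a n p_prime a_dvd cardK.
  by rewrite cardF.
have SKE : kth_powers K k' = [set x | x ^+ m == 1]%R.
  by apply: kth_powersE; rewrite k'm cardK subn1.
have S_codom s : s \in kth_powers F k -> s \in codom f.
  rewrite SE inE codom_rmorphism_fixed cardK => /eqP sm1.
  have [c pa_c] := dvdnP m_dvd_a.
  rewrite -[p ^ a]prednK ?expn_gt0 ?prime_gt0 // -subn1 pa_c.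
  by rewrite exprS mulnC exprM sm1 expr1n mulr1.
have E_codom y : y \in E -> y \in codom f.
  rewrite -[y]subr0 -connE => /connectP[r]; elim: r y => [|z r IHr] y /=.
    by move=> _ <-; rewrite subr0 -(rmorph0 f) codom_f.
  case/andP => /S_codom/codomP[u uE] zr /(IHr z zr)/codomP[v]; rewrite subr0 => zE.
  by apply/codomP; exists (u + v)%R; rewrite rmorphD -uE -zE subr0 subrK.
have f_inj : injective f := fmorph_inj f.
(* The image of [f] contains [E], which has [p ^ b] elements, and has only [p ^ a <= p ^ b] elements
   itself. *)
have codomE y : (y \in codom f) = (y \in E).
  have sub : [pred y : F | y \in E] \subset codom f.
    by apply/subsetP => z; apply: E_codom.
  suff /subset_cardP/(_ sub) <- : #|[pred y : F | y \in E]| = #|codom f| by [].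
  apply/eqP; rewrite eqn_leq subset_leq_card //=.
  by rewrite card_codom // cardK cardE leq_exp2l ?prime_gt1.
have conn_f z : connect (paley F k) x (x + f z)%R.
  by rewrite connE opprD addrA subrr add0r -rmorphN -codomE codom_f.
pose g (z : K) : {y : F | connect (paley F k) x y} := Sub (x + f z)%R (conn_f z).
have g_inj : injective g by move=> u v /(congr1 val)/addrI/f_inj.
(* Both adjacencies say that the difference is an m-th root of unity, and the injective morphism [f]
   preserves and reflects this. *)
have g_adj u v : component (paley F k) x (g u) (g v) = paley K k' u v.
  rewrite /component /paley /= SE SKE !inE opprD addrACA subrr add0r.
  by rewrite -rmorphB -rmorphXn /= fmorph_eq1.
have g_surj y : y \in codom g.
  have := valP y; rewrite connE -codomE => /codomP[z zE]; apply/codomP.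
  (* The sign appears because connectivity puts [x - y], not [y - x], in [E]. *)
  exists (- z)%R; apply: val_inj; rewrite /= rmorphN -zE opprB.
  by rewrite addrC subrK.
pose h y := iinv (g_surj y).
have hK : cancel h g by move=> y; apply: f_iinv.
have gK : cancel g h by move=> z; apply: g_inj; rewrite hK.
by exists h; split=> [|u v]; [exists g | rewrite -g_adj !hK].
Qed.
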